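(* Let $f:\mathbb{R}\to\mathbb{R}$ be a differentiable function with bounded derivative and let $F:L^2(\mathbb{T})\to L^2(\mathbb{T})$ be defined by $F(u)(x)=f(u(x))$. Then the following are equivalent: (i) $F$ is Gateaux differentiable and there exists a constant $L>0$ such that for all $u\in L^2(\mathbb{T})$ and $v\in\mathrm{Dom}(1-\Delta)$ $$\big\|(1-\Delta)^{-1}F'(u)(1-\Delta)v\big\|_{L^2(\mathbb{T})}\le L\|v\|_{L^2(\mathbb{T})};$$ (ii) $f$ is affine linear.
   Context: $\mathbb{T}=\mathbb{R}/\mathbb{Z}$ is the one-dimensional torus; $\Delta$ is the Laplacian on $\mathbb{T}$, and $\mathrm{Dom}(1-\Delta)\subset L^2(\mathbb{T})$ is the domain of $1-\Delta$ as an unbounded operator on $L^2(\mathbb{T})$. $F'(u)$ denotes the Gateaux derivative of $F$ at $u$, a bounded linear operator on $L^2(\mathbb{T})$. *)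

(* Defs.v *)
From HB Require Import structures.
From mathcomp Require Import all_boot all_order all_algebra.
From mathcomp Require Import all_classical all_reals all_analysis.
From mathcomp Require Import measurable_realfun ess_sup_inf.

Set Implicit Arguments.
Unset Strict Implicit.
Unset Printing Implicit Defensive.
Import Order.TTheory GRing.Theory Num.Theory.
Import numFieldNormedType.Exports.
Local Open Scope classical_set_scope.
Local Open Scope quotient_scope.
Local Open Scope ring_scope.

(* The library provides the quotient type [LspaceType] of L^p functions modulo
   a.e. equality, but no algebraic structure on it; here it becomes a normed
   space with the L^p norm and the pointwise operations. *)
Section Lspace_normedModType.
Context d (T : measurableType d) (R : realType).
Variables (mu : {measure set T -> \bar R}) (p : \bar R) (p1 : (1 <= p)%E).
Local Notation Lp := (LspaceType mu p1).
Local Notation Lf := (LfunType mu p1).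
Local Notation quo := {mfun_ mu, T >-> measurableTypeR R}.

HB.instance Definition _ := gen_eqMixin Lp.
HB.instance Definition _ := gen_choiceMixin Lp.

Lemma ae_eq_Lnorm (f g : T -> R) : measurable_fun setT f ->
  measurable_fun setT g -> f = g %[ae mu] ->
  'N[mu]_p[EFin \o f]%E = 'N[mu]_p[EFin \o g]%E.
Proof.
move=> mf mg fg.
have mpow r (h : T -> R) : measurable_fun setT h ->
    measurable_fun setT (fun x => `|(EFin \o h) x| `^ r)%E.
  move=> /measurable_EFinP mh.
  have mk := measurableT_comp (@abse_measurable R _) mh.
  exact: (measurableT_comp (measurable_poweR r) mk).
rewrite unlock /Lnorm; case: p p1 => [r _|_|//].
- congr (_ `^ _)%E; apply: ge0_ae_eq_integral => //.
  + exact: mpow.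
  + exact: mpow.
  + by move=> x _; rewrite poweR_ge0.
  + by move=> x _; rewrite poweR_ge0.
  + by apply: filterS fg => x fg _ /=; rewrite fg.
- case: ifPn => // _; apply: eq_ess_sup.
  by apply: filterS fg => x fg /=; rewrite fg.
Qed.

(* [LspaceType] is built on functions with values in [measurableTypeR R] and
   [LfunType] on functions with values in [R]: same sigma-algebra, distinct
   structures. *)
Lemma mfun_of_Lfun_subproof (f : Lf) :
  @measurable_fun _ _ T (measurableTypeR R) setT f.
Proof. exact: (@measurable_funPT _ _ _ _ f). Qed.

Definition mfun_of_Lfun (f : Lf) : {mfun T >-> measurableTypeR R} :=
  HB.pack (f : T -> R)
    (isMeasurableFun.Build _ _ T (measurableTypeR R) f
       (mfun_of_Lfun_subproof f)).

Lemma Lspace_measurable (u : Lp) : measurable_fun setT (u : T -> R).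
Proof. exact: (@measurable_funPT _ _ _ _ (repr (u : quo))). Qed.

Lemma Lspace_Lfun (u : Lp) : (u : T -> R) \in Lfun mu p.
Proof.
rewrite !inE; apply/andP; split; apply/mem_set.
- exact: Lspace_measurable.
- exact: Lebesgue_finite.
Qed.

Definition Lfun_of_Lspace (u : Lp) : Lf := Lfun_Sub p1 (Lspace_Lfun u).

Lemma pi_ae_eq (f : {mfun T >-> measurableTypeR R}) :
  ((\pi_quo f : quo) : T -> R) = f %[ae mu].
Proof.
have /eqP : \pi_quo (repr (\pi_quo f)) = \pi_quo f by rewrite reprK.
by rewrite eqmodE => /asboolP.
Qed.

Lemma Lspace_of_Lfun_subproof (f : Lf) :
  finite_norm mu p ((\pi_quo (mfun_of_Lfun f) : quo) : T -> R).
Proof.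
rewrite /finite_norm (ae_eq_Lnorm _ _ (pi_ae_eq (mfun_of_Lfun f))).
- exact: Lfunction_finite.
- exact: (@measurable_funPT _ _ _ _ (repr (\pi_quo (mfun_of_Lfun f)))).
- exact: (@measurable_funPT _ _ _ _ f).
Qed.

Definition Lspace_of_Lfun (f : Lf) : Lp :=
  HB.pack (\pi_quo (mfun_of_Lfun f))
    (isFinLebesgue.Build _ T R mu p p1 _ (Lspace_of_Lfun_subproof f)).

Lemma Lspace_of_LfunE (f : Lf) : Lspace_of_Lfun f = f %[ae mu].
Proof. exact: pi_ae_eq. Qed.

Lemma LspaceP (u v : Lp) : u = v <-> (u : T -> R) = v %[ae mu].
Proof.
split=> [->//|uv]; first exact: ae_eq_refl.
have : (u : quo) = v :> quo.
  rewrite -[LHS]reprK -[RHS]reprK; apply/eqP; rewrite eqmodE; exact/asboolP.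
case: u v {uv} => [u [[uP]]] [v [[vP]]] /= uv.
move: uP vP; rewrite uv => uP vP; by rewrite (Prop_irrelevance uP vP).
Qed.

Let add (u v : Lp) := Lspace_of_Lfun (Lfun_of_Lspace u + Lfun_of_Lspace v).
Let opp (u : Lp) := Lspace_of_Lfun (- Lfun_of_Lspace u).
Let zero : Lp := Lspace_of_Lfun 0.
Let scale (a : R) (u : Lp) := Lspace_of_Lfun (a *: Lfun_of_Lspace u).
Let norm (u : Lp) : R := fine 'N[mu]_p[EFin \o u].

Let addE u v : add u v = (u : T -> R) \+ v %[ae mu].
Proof. exact: Lspace_of_LfunE. Qed.
Let oppE u : opp u = \- (u : T -> R) %[ae mu].
Proof. exact: Lspace_of_LfunE. Qed.
Let zeroE : zero = (fun _ : T => 0 : R) %[ae mu].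
Proof. exact: Lspace_of_LfunE. Qed.
Let scaleE a u : scale a u = (fun x => a * (u : T -> R) x) %[ae mu].
Proof. exact: Lspace_of_LfunE. Qed.


Let addA : associative add.
Proof.
move=> u v w; apply/LspaceP.
apply: filter_app (addE u (add v w)); apply: filter_app (addE v w).
apply: filter_app (addE (add u v) w); apply: filter_app (addE u v).
by apply: aeW => x /(_ I)/= e1 /(_ I)/= e2 /(_ I)/= e3 /(_ I)/= e4 _;
  rewrite e4 e3 e2 e1 addrA.
Qed.

Let addC : commutative add.
Proof.
move=> u v; apply/LspaceP.
apply: filter_app (addE u v); apply: filter_app (addE v u).
by apply: aeW => x /(_ I)/= e1 /(_ I)/= e2 _; rewrite e2 e1 addrC.
Qed.

Let add0 : left_id zero add.
Proof.
move=> u; apply/LspaceP.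
apply: filter_app (addE zero u); apply: filter_app zeroE.
by apply: aeW => x /(_ I)/= e1 /(_ I)/= e2 _; rewrite e2 e1 add0r.
Qed.

Let addN : left_inverse zero opp add.
Proof.
move=> u; apply/LspaceP.
apply: filter_app (addE (opp u) u); apply: filter_app (oppE u).
apply: filter_app zeroE.
by apply: aeW => x /(_ I)/= e1 /(_ I)/= e2 /(_ I)/= e3 _;
  rewrite e3 e2 e1 addNr.
Qed.

HB.instance Definition _ := GRing.isZmodule.Build Lp addA addC add0 addN.

Let scaleA a b u : scale a (scale b u) = scale (a * b) u.
Proof.
apply/LspaceP.
apply: filter_app (scaleE a (scale b u)); apply: filter_app (scaleE b u).
apply: filter_app (scaleE (a * b) u).
by apply: aeW => x /(_ I)/= e1 /(_ I)/= e2 /(_ I)/= e3 _;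
  rewrite e3 e2 e1 mulrA.
Qed.

Let scale1 : left_id 1 scale.
Proof.
move=> u; apply/LspaceP; apply: filter_app (scaleE 1 u).
by apply: aeW => x /(_ I)/= e1 _; rewrite e1 mul1r.
Qed.

Let scaleDr : right_distributive scale +%R.
Proof.
move=> a u v; apply/LspaceP.
apply: filter_app (scaleE a (add u v)); apply: filter_app (addE u v).
apply: filter_app (addE (scale a u) (scale a v)).
apply: filter_app (scaleE a u); apply: filter_app (scaleE a v).
by apply: aeW => x /(_ I)/= e1 /(_ I)/= e2 /(_ I)/= e3 /(_ I)/= e4
  /(_ I)/= e5 _; rewrite e5 e4 e3 e2 e1 mulrDr.
Qed.

Let scaleDl u : {morph scale^~ u : a b / a + b}.
Proof.
move=> a b; apply/LspaceP.
apply: filter_app (scaleE (a + b) u).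
apply: filter_app (addE (scale a u) (scale b u)).
apply: filter_app (scaleE a u); apply: filter_app (scaleE b u).
by apply: aeW => x /(_ I)/= e1 /(_ I)/= e2 /(_ I)/= e3 /(_ I)/= e4 _;
  rewrite e4 e3 e2 e1 mulrDl.
Qed.

HB.instance Definition _ :=
  GRing.Zmodule_isLmodule.Build R Lp scaleA scale1 scaleDr scaleDl.

Let norm_Lspace_of_Lfun (f : Lf) :
  norm (Lspace_of_Lfun f) = fine 'N[mu]_p[EFin \o f]%E.
Proof.
rewrite /norm; congr fine; apply: ae_eq_Lnorm.
- exact: Lspace_measurable.
- exact: (@measurable_funPT _ _ _ _ f).
- exact: Lspace_of_LfunE.
Qed.

Let normD u v : norm (u + v) <= norm u + norm v.
Proof. by rewrite norm_Lspace_of_Lfun; exact: ler_LnormD. Qed.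

Let normZ a u : norm (a *: u) = `|a| * norm u.
Proof.
rewrite norm_Lspace_of_Lfun -[RHS]/(fine (`|a|%:E) * norm u) /norm.
have h := LnormZ (Lfun_of_Lspace u) a.
rewrite [X in fine X]h fineM// ge0_fin_numE ?Lnorm_ge0//.
exact: Lebesgue_finite.
Qed.

Let norm_eq0 u : norm u = 0 -> u = 0.
Proof.
move=> u0; apply/LspaceP.
have := @fine_Lnormr_eq0 _ _ _ _ _ p1 (Lfun_of_Lspace u) u0.
move=> u00; apply: filter_app u00; apply: filter_app zeroE.
by apply: aeW => x /(_ I)/= e1 /(_ I)/= e2 _; rewrite e1 e2.
Qed.

HB.instance Definition _ :=
  @Lmodule_isNormed.Build R Lp norm normD normZ norm_eq0.

Lemma LspaceD (u v : Lp) :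
  (u + v : T -> R) = (fun x => (u : T -> R) x + (v : T -> R) x) %[ae mu].
Proof. exact: addE. Qed.

Lemma LspaceN (u : Lp) : (- u : T -> R) = (fun x => - (u : T -> R) x) %[ae mu].
Proof. exact: oppE. Qed.

Lemma Lspace0 : ((0 : Lp) : T -> R) = (fun=> 0) %[ae mu].
Proof. exact: zeroE. Qed.

Lemma LspaceZ a (u : Lp) :
  (a *: u : T -> R) = (fun x => a * (u : T -> R) x) %[ae mu].
Proof. exact: scaleE. Qed.

Lemma Lspace_normE (u : Lp) : `|u| = fine 'N[mu]_p[EFin \o u]%E.
Proof. by []. Qed.

End Lspace_normedModType.

Section gateaux.
Context (R : realType) (V W : normedModType R).

(* When this holds, the Gateaux derivative F'(u) is the map [v |-> 'D_v F u]. *)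
Definition gateaux_differentiable (F : V -> W) (u : V) : Prop :=
  exists A : {linear V -> W},
    continuous A /\ forall v : V, is_derive u v F (A v).

End gateaux.

Section torus.
Context (R : realType).

(* The torus R/Z is represented by its fundamental domain [0, 1]:
   [uniform_prob] is the restriction of the Lebesgue measure to [0, 1], so
   elements of [L2T] are functions on the line whose values outside [0, 1] are
   immaterial. Periodicity enters through the boundary conditions in
   [torus_deriv]. *)
Definition torus_measure := @uniform_prob R 0 1 ltr01.
HB.instance Definition _ := Probability.on torus_measure.

Definition L2T : Type := LspaceType2 torus_measure.
HB.instance Definition _ := NormedModule.on L2T.

(* [v] is in H^1(T) with derivative [w] in L^2(T): [v] has an absolutely
   continuous 1-periodic representative [V] with V' = [w] a.e. *)
Definition torus_deriv (v w : L2T) : Prop :=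
  exists V : R -> R,
    [/\ (v : R -> R) = V %[ae torus_measure],
        V 0 = V 1 &
        forall x : R, 0 <= x <= 1 ->
          V x = V 0 + \int[lebesgue_measure]_(t in `[0, x]) (w : R -> R) t].

Definition laplacian_graph (v w : L2T) : Prop :=
  exists2 v' : L2T, torus_deriv v v' & torus_deriv v' w.

(* The domain H^2(T) of the Laplacian, hence also of [1 - Delta]. *)
Definition dom_laplacian : set L2T := [set v | exists w, laplacian_graph v w].

(* [w] is determined by [v] in [laplacian_graph v w]; the default value 0 of
   [xget] is only used outside the domain. *)
Definition laplacian (v : L2T) : L2T := xget 0 [set w | laplacian_graph v w].

Definition one_minus_laplacian (v : L2T) : L2T := v - laplacian v.

(* [1 - Delta] is a bijection from its domain onto L^2(T), so the default value
   0 of [xget] is never used. *)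
Definition inv_one_minus_laplacian (g : L2T) : L2T :=
  xget 0 [set v | dom_laplacian v /\ one_minus_laplacian v = g].

End torus.

Arguments torus_measure : clear implicits.

(* Main.v *)
(* If f' takes two values, f'(x0) = c + d and f'(y0) = c with d != 0, let u be
   the step function equal to x0 on I = [0, 1/2] and to y0 on ]1/2, 1], so that
   F'(u) is multiplication by c + d 1_I. For v = sin (t x) / t, where t is an
   odd multiple of 2 pi, the function 1_I (v - v'') is (1 - Delta) e with
   e = 1_I v + k, where k is a multiple of cosh (x - 1/4) on I and of
   cosh (x - 3/4) off I: k solves k = k'' on both pieces, and its coefficient is
   chosen so that the jumps of k' at 0 and 1/2 cancel those of (1_I v)'; it does
   not depend on t. Hence (1 - Delta)^-1 F'(u) (1 - Delta) v = c v + d e, and as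
   t goes to infinity v tends to 0 in L^2 while e tends to k != 0, which
   contradicts the bound. *)
Require Import Defs.
From mathcomp Require Import all_boot all_order all_algebra.
From mathcomp Require Import all_classical all_reals all_analysis.
From mathcomp Require Import measurable_realfun ring lra.

Import Order.TTheory GRing.Theory Num.Theory.
Import numFieldNormedType.Exports.
Local Open Scope classical_set_scope.
Local Open Scope ring_scope.

Section torus_sobolev.
Context {R : realType}.
Local Notation leb := (@lebesgue_measure R).
Local Notation torus := (torus_measure R).
(* The filter instance of [almost_everywhere] is not found by unification for
   these two measures. *)
Local Notation lebF := (@filterS _ _ (ae_filter_ringOfSetsType leb)).
Local Notation lebF2 := (@filterS2 _ _ (ae_filter_ringOfSetsType leb)).
Local Notation torusF := (@filterS _ _ (ae_filter_ringOfSetsType torus)).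
Local Notation torusF2 := (@filterS2 _ _ (ae_filter_ringOfSetsType torus)).
Local Notation torusF3 := (@filterS3 _ _ (ae_filter_ringOfSetsType torus)).

(** * The torus measure as Lebesgue measure on [0, 1] *)

Lemma torus_measureE (A : set R) : measurable A ->
  torus A = leb (A `&` `[0, 1]).
Proof.
move=> mA; rewrite /torus_measure /uniform_prob integral_uniform_pdf.
rewrite (eq_integral (cst 1%E)) ?integral_cst ?mul1e//; first exact: measurableI.
move=> x; rewrite inE => -[_ /=]; rewrite in_itv/= /uniform_pdf => ->.
by rewrite subr0 invr1.
Qed.

(** The complement of [0, 1] is null for the torus measure, so it can be added to an exceptional set
    or removed from it. *)
Lemma ae_torusP (P : set R) :
  (\forall x \ae torus, P x) <-> (\forall x \ae leb, x \in `[0, 1] -> P x).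
Proof.
split=> -[A [mA A0 PA]].
- exists (A `&` `[0, 1]); split; first exact: measurableI.
    by rewrite -torus_measureE.
  move=> x /= /not_implyP[x01 Px]; split=> //.
  exact: PA.
- exists (A `|` ~` `[0, 1]); split.
  + by apply: measurableU => //; exact: measurableC.
  + rewrite torus_measureE; last by apply: measurableU => //; exact: measurableC.
    rewrite setIUl setICl setU0.
    apply/eqP; rewrite -measure_le0 -A0 le_measure ?inE//.
    exact: measurableI.
  + move=> x /= Px; have [x01|/negP] := boolP (x \in `[0, 1]); [left|by right].
    by apply: PA => /= /(_ x01).
Qed.

Lemma L2T_measurable (w : L2T R) : measurable_fun setT (w : R -> R).
Proof. exact: (@Lspace_measurable _ _ _ _ _ _ w). Qed.

Lemma L2T_integrable (w : L2T R) : leb.-integrable `[0, 1] (EFin \o w).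
Proof.
have : (w : R -> R) \in Lfun torus 1.
  (* The measure is finite, hence L^2 is contained in L^1. *)
  apply: Lfun_subset12; last exact: (Lspace_Lfun w).
  exact: fin_num_measure.
move=> /Lfun1_integrable/integrableP[mw].
rewrite integral_uniform//; last exact: (measurableT_comp (@abse_measurable R _) mw).
rewrite subr0 invr1 mul1e => wy; apply/integrableP; split => //.
exact: measurable_funTS.
Qed.

Lemma ae_eq_Rintegral_torus (f g : R -> R) (D : set R) :
  measurable D -> D `<=` `[0, 1] ->
  measurable_fun D f -> measurable_fun D g -> f = g %[ae torus] ->
  \int[leb]_(t in D) f t = \int[leb]_(t in D) g t.
Proof.
move=> mD D01 mf mg /ae_torusP fg; congr fine; apply: ae_eq_integral => //.
- exact/measurable_EFinP.
- exact/measurable_EFinP.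
- apply: (lebF _ fg) => t /= ft Dt.
  by rewrite ft//; exact: D01.
Qed.

(** * Weak derivatives on the torus: linearity, kernel and eigenvectors *)

Lemma L2T_linE (a : R) (v w : L2T R) :
  (a *: v + w : R -> R) = (fun x => a * (v : R -> R) x + (w : R -> R) x) %[ae torus].
Proof.
apply: (torusF2 _ (LspaceD (a *: v) w) (LspaceZ a v)) => x.
by move=> /(_ I) e1 /(_ I) e2 _; rewrite e1 e2.
Qed.

Lemma torus_deriv_lin (a : R) (v w v' w' : L2T R) :
  torus_deriv v w -> torus_deriv v' w' ->
  torus_deriv (a *: v + v') (a *: w + w').
Proof.
move=> [V [vV V01 Vw]] [V' [vV' V'01 Vw']].
exists (fun x => a * V x + V' x); split; last 2 first.
- by rewrite V01 V'01.
- move=> x x01; rewrite Vw// Vw'//.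
  have sub : `[0, x]%classic `<=` `[0, 1]%classic.
    by apply: subset_itvl; rewrite bnd_simp; case/andP: x01.
  have int (u : L2T R) : leb.-integrable `[0, x] (EFin \o u).
    by apply: integrableS (L2T_integrable u) => //.
  rewrite (ae_eq_Rintegral_torus _ _ _ _ _ _ _ (L2T_linE a w w'))//; last 2 first.
  + by apply: measurable_funTS; exact: L2T_measurable.
  + apply: measurable_funTS; apply: measurable_funD; last exact: L2T_measurable.
    by apply: measurable_funM => //; exact: L2T_measurable.
  rewrite RintegralD//; last exact: (integrableZl _ a (int w)).
  by rewrite RintegralZl// mulrDr addrACA.
- apply: (torusF3 _ vV vV' (L2T_linE a v v')) => x.
  by move=> /(_ I) e1 /(_ I) e2 /(_ I) e3 _; rewrite e3 e2 e1.
Qed.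

Lemma parameterized_L2T_continuous (c : R) (w : L2T R) :
  {within `[0, 1], continuous (fun x => c + \int[leb]_(t in `[0, x]) (w : R -> R) t)}.
Proof.
move=> x; apply: cvgD; first exact: cvg_cst.
exact: (parameterized_integral_continuous ler01 (L2T_integrable w)).
Qed.

Lemma derive1_cst_oo (f : R -> R) (a b c x : R) :
  {in `]a, b[, f =1 cst c} -> x \in `]a, b[ -> f^`()%classic x = 0.
Proof.
move=> fc xab; rewrite derive1E.
rewrite (@near_eq_derive _ _ _ _ (cst c)) ?derive_cst//.
by near=> y; apply: fc; near: y; exact: near_in_itvoo.
Unshelve. all: by end_near. Qed.

(** By continuity [f] is the derivative of its primitive, and that primitive vanishes because [f] is
    zero a.e. *)
Lemma continuous_ae_torus0 (f : R -> R) :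
  {within `[0, 1], continuous f} -> f = cst 0 %[ae torus] ->
  {in `]0, 1[, f =1 cst 0}.
Proof.
move=> cf f0 x x01.
have intf : leb.-integrable `[0, 1] (EFin \o f).
  by apply: continuous_compact_integrable => //; exact: segment_compact.
have x0 : 0 < x by rewrite (itvP x01).
have x1 : x < 1 by rewrite (itvP x01).
have [_ <-] := @continuous_FTC1_closed _ f 0 x 1 x1 intf x0
   (within_continuous_continuous ltr01 cf x01).
apply: (@derive1_cst_oo _ 0 1 0) => // y y01.
have y1 : y <= 1 by rewrite (itvP y01).
have sub : `[0, y]%classic `<=` `[0, 1]%classic.
  by apply: subset_itvl; rewrite bnd_simp.
rewrite (ae_eq_Rintegral_torus f (cst 0))//.
  by rewrite Rintegral_cst//= mul0r.
apply: measurable_funS sub _ => //.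
exact: subspace_continuous_measurable_fun.
Qed.

(** The primitive of [w] is continuous and a.e. constant, hence constant, and Lebesgue
    differentiation recovers [w] from it a.e. By linearity this makes weak derivatives unique. *)
Lemma torus_deriv0 (w : L2T R) : torus_deriv 0 w -> w = 0.
Proof.
move=> [V [V0 _ Vw]].
pose G x := V 0 + \int[leb]_(t in `[0, x]) (w : R -> R) t.
have G0 : {in `]0, 1[, G =1 cst 0}.
  apply: continuous_ae_torus0; first exact: parameterized_L2T_continuous.
  have : V = cst 0 %[ae torus].
    apply: (torusF2 _ V0 (@Lspace0 _ _ _ torus _ (lee1n 2))) => x.
    by move=> /(_ I) e1 /(_ I) e2 _; rewrite -e1 e2.
  move=> /ae_torusP h. apply/ae_torusP.
  apply: (lebF _ h) => t /= + t01 _.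
  by move=> /(_ t01 I) <-; rewrite /G -Vw.
(* Cutting [w] off outside [0, 1] makes it locally integrable on the whole line, as Lebesgue
   differentiation requires. *)
have locw : locally_integrable [set: R] (w \_ `[0, 1]).
  by apply: integrable_locally => //; exact: L2T_integrable.
have int01 := L2T_integrable w.
have intw y : leb.-integrable `[0, y] (EFin \o w \_ `[0, 1]).
  rewrite -restrict_EFin; apply/integrable_restrict => //=.
  by apply: integrableS int01 => //; exact: measurableI.
have := @FTC1 _ (w \_ `[0, 1]) (BLeft 0) intw locw.
move=> H; suff : \forall x \ae torus, (w : R -> R) x = 0.
  move=> w0; apply/LspaceP.
  apply: (torusF2 _ w0 (@Lspace0 _ _ _ torus _ (lee1n 2))) => x wx /(_ I) e _.
  by rewrite wx e.
apply/ae_torusP.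
(* The endpoints are discarded: the derivative at [x] is computed from a neighbourhood of [x] inside
   ]0, 1[. *)
have N : \forall x \ae leb, x != 0 /\ x != 1.
  exists [set 0; 1]; split; first by apply: measurableU.
    by apply: countable_lebesgue_measure0; exact: finite_set_countable.
  move=> x /= /not_andP[] /negP/negPn/eqP; [by left|by right].
apply: (lebF2 _ N H) => x /= [x0 x1] + x01.
have {}x01' : x \in `]0, 1[.
  move: x01; rewrite !in_itv/= => /andP[xge0 xle1].
  by rewrite !lt_neqAle xge0 xle1 x1 eq_sym x0.
rewrite patchE ifT; last by rewrite inE/=.
case; first by rewrite lte_fin (itvP x01').
move=> _ <-.
apply: (@derive1_cst_oo _ 0 1 (- V 0)) => // y y01.
transitivity (\int[leb]_(t in `[0, y]) (w : R -> R) t).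
  apply: eq_Rintegral => t. rewrite inE/= patchE => ty.
  rewrite ifT// inE/=; apply: subset_itvl ty.
  by rewrite bnd_simp (itvP y01).
by have := G0 y y01; rewrite /G /= => /eqP; rewrite addr_eq0 => /eqP ->; rewrite opprK.
Qed.

(* [exp (- a x) V x] is constant *)
Lemma torus_deriv_eigen0 (a : R) (g : L2T R) : a != 0 -> torus_deriv g (a *: g) -> g = 0.
Proof.
move=> a0 [V [gV V01 VE]].
pose G x := V 0 + \int[leb]_(t in `[0, x]) ((a *: g : L2T R) : R -> R) t.
have cG : {within `[0, 1], continuous G} by exact: parameterized_L2T_continuous.
have VG : {in `[0, 1], V =1 G} by move=> x x01; exact: VE.
have gG : \forall x \ae leb, x \in `[0, 1] -> (g : R -> R) x = G x.
  move/ae_torusP : gV; apply: lebF => x gx x01.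
  by rewrite gx// VG.
have intG : leb.-integrable `[0, 1] (EFin \o G).
  by apply: continuous_compact_integrable => //; exact: segment_compact.
(* Replacing [g] by its continuous version [G] under the integral turns the hypothesis into an
   integral equation, so [G] is differentiable on ]0, 1[ with derivative [a * G]. *)
have Geq (x : R) : x \in `[0, 1] -> G x = V 0 + a * \int[leb]_(t in `[0, x]) G t.
  move=> x01; congr (_ + _).
  have sub : `[0, x]%classic `<=` `[0, 1]%classic.
    by apply: subset_itvl; rewrite bnd_simp (itvP x01).
  rewrite -RintegralZl//; last exact: integrableS intG.
  apply: ae_eq_Rintegral_torus => //.
  - by apply: measurable_funTS; exact: L2T_measurable.
  - apply: measurable_funM => //; apply: measurable_funS sub _ => //.
    exact: subspace_continuous_measurable_fun.
  - move/ae_torusP : gG => gG; apply: (torusF2 _ gG (LspaceZ a g)) => x' e /(_ I) e' _.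
    by rewrite e' e.
have dG (x : R) : x \in `]0, 1[ -> is_derive x 1 G (a * G x).
  move=> x01.
  have x0 : 0 < x by rewrite (itvP x01).
  have x1 : x < 1 by rewrite (itvP x01).
  have [d1 d2] := @continuous_FTC1_closed _ G 0 x 1 x1 intG x0
   (within_continuous_continuous ltr01 cG x01).
  apply: (@near_eq_is_derive _ _ _ (fun y : R => V 0 + a * \int[leb]_(t in `[0, y]) G t)).
    near=> y; apply/esym/Geq; apply: subset_itv_oo_cc.
    by near: y; exact: near_in_itvoo.
  have d3 : is_derive x 1 (fun y : R => \int[leb]_(t in `[0, y]) G t) (G x).
    by apply: (DeriveDef d1); rewrite -derive1E; exact: d2.
  have := is_deriveD (is_derive_cst (V 0) x 1) (is_deriveZ a d3).
  by rewrite add0r.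
have dexp (x : R) : is_derive x 1 (fun y : R => expR (- a * y)) (- a * expR (- a * x)).
  by apply: is_derive_eq; rewrite scaler1 /= mulrC.
have E1 : {in `[0, 1], forall x : R, expR (- a * x) * G x = G 0}.
  move=> x x01.
  have x0 : 0 <= x by rewrite (itvP x01).
  have x1 : x <= 1 by rewrite (itvP x01).
  pose h (y : R) := expR (- a * y) * G y.
  have sub : `[0, x]%classic `<=` `[0, 1]%classic.
    by apply: subset_itvl; rewrite bnd_simp.
  have dh (y : R) : y \in `]0, x[ -> is_derive y 1 h (cst 0 y).
    move=> yx; have yx1 : y \in `]0, 1[ by apply: subset_itvl yx; rewrite bnd_simp.
    apply: is_derive_eq (is_deriveM (dexp y) (dG y yx1)) _.
    rewrite /= /GRing.scale /=; ring.
  have ch : {within `[0, x], continuous h}.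
    move=> y; apply: cvgM; last exact: continuous_subspaceW sub cG y.
    apply: continuous_subspaceT => z; apply/differentiable_continuous/derivable1_diffP.
    by have [] := dexp z.
  have [y _] := MVT_segment x0 dh ch.
  by rewrite /h /= mulr0 expR0 mul1r mul0r => /eqP; rewrite subr_eq0 => /eqP.
(* Periodicity gives [expR (- a) * G 0 = G 0], and [expR (- a)] differs from 1 since [a] is
   nonzero. *)
have G0 : G 0 = 0.
  have : G 0 = G 1.
    by rewrite -!VG//; rewrite in_itv/= ?lexx ?ler01.
  move=> G01.
  have /E1 : (1 : R) \in `[0, 1] by rewrite in_itv/= lexx ler01.
  rewrite mulr1 -G01 -[X in _ = X]mul1r => /eqP; rewrite -subr_eq0 -mulrBl mulf_eq0.
  rewrite subr_eq0 -expR0 => /orP[/eqP/expR_inj/eqP|/eqP//].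
  by rewrite oppr_eq0 (negbTE a0).
have {}gG : \forall x \ae torus, (g : R -> R) x = 0.
  apply/ae_torusP; apply: lebF gG => x gx x01.
  rewrite gx//; move: (E1 x x01); rewrite G0 => /eqP.
  by rewrite mulf_eq0 gt_eqF ?expR_gt0//= => /eqP.
apply/LspaceP.
apply: (torusF2 _ gG (@Lspace0 _ _ _ torus _ (lee1n 2))) => x gx /(_ I) e _.
by rewrite gx e.
Unshelve. all: by end_near. Qed.

(** * The Laplacian and the inverse of 1 - Delta *)

Lemma laplacian_graph_lin (a : R) (v w v' w' : L2T R) :
  laplacian_graph v w -> laplacian_graph v' w' ->
  laplacian_graph (a *: v + v') (a *: w + w').
Proof.
move=> [z vz zw] [z' vz' zw']; exists (a *: z + z'); exact: torus_deriv_lin.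
Qed.

Lemma torus_deriv_unique (v w w' : L2T R) :
  torus_deriv v w -> torus_deriv v w' -> w = w'.
Proof.
move=> vw vw'; have := torus_deriv_lin (-1) _ _ _ _ vw vw'.
rewrite !scaleN1r addNr => /torus_deriv0 /eqP.
by rewrite addrC subr_eq0 => /eqP.
Qed.

Lemma laplacianE (v w : L2T R) : laplacian_graph v w -> laplacian v = w.
Proof.
move=> vw; rewrite /laplacian.
have [z vz zl] : laplacian_graph v (xget 0 [set w | laplacian_graph v w]).
  exact: (xgetPex 0 (ex_intro _ w vw)).
have [z' vz' zw] := vw.
rewrite (torus_deriv_unique _ _ _ vz vz') in zl.
exact: torus_deriv_unique zl zw.
Qed.

(** Injectivity of 1 - Delta, by factoring it into first-order operators: [v + v'] and [v - v'] are
    eigenvectors of the derivative for 1 and -1, so both vanish, and so does their sum [v + v]. *)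
Lemma laplacian_graph_eigen0 (v : L2T R) : laplacian_graph v v -> v = 0.
Proof.
move=> [v' vv' v'v].
have D1 : v' + v = 0.
  apply: (torus_deriv_eigen0 1); first exact: oner_neq0.
  rewrite scale1r [X in torus_deriv _ X]addrC.
  by have := torus_deriv_lin 1 _ _ _ _ v'v vv'; rewrite !scale1r.
have D2 : - v' + v = 0.
  apply: (torus_deriv_eigen0 (-1)); first by rewrite oppr_eq0 oner_neq0.
  rewrite scaleN1r opprD opprK addrC.
  have := torus_deriv_lin (-1) _ _ _ _ v'v vv'.
  by rewrite !scaleN1r addrC [X in torus_deriv _ X]addrC.
have : v + v = 0.
  transitivity ((v' + v) + (- v' + v)); first by rewrite addrACA subrr add0r.
  by rewrite D1 D2 addr0.
move=> /eqP; rewrite -mulr2n -scaler_nat scaler_eq0 pnatr_eq0/= => /eqP//.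
Qed.

(** The set under [xget] contains [v], so the chosen [u] solves the same equation; then [v - u] is
    its own Laplacian and vanishes. *)
Lemma inv_one_minus_laplacianE (v w : L2T R) :
  laplacian_graph v w -> inv_one_minus_laplacian (v - w) = v.
Proof.
move=> vw; rewrite /inv_one_minus_laplacian.
set A := [set _ | _].
have [[w' vw']] : A (xget 0 A).
  apply: (xgetPex 0); exists v; split; first by exists w.
  by rewrite /one_minus_laplacian (laplacianE _ _ vw).
move: (xget 0 A) vw' => u uw'; rewrite /one_minus_laplacian (laplacianE _ _ uw') => e.
have := laplacian_graph_lin (-1) _ _ _ _ uw' vw.
have -> : -1 *: w' + w = -1 *: u + v.
  have -> : w' = u - (v - w) by rewrite -e subKr.
  by rewrite !scaleN1r opprB addrAC subrK addrC.
by move=> /laplacian_graph_eigen0/eqP; rewrite scaleN1r addrC subr_eq0 => /eqP ->.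
Qed.

(** * Bounding the L^2 norm by an essential bound *)

Lemma Lnorm_torus_le (f : R -> R) (K : R) : 0 <= K -> measurable_fun setT f ->
  (\forall x \ae torus, `|f x| <= K) -> ('N[torus]_2%:E[EFin \o f] <= K%:E)%E.
Proof.
move=> K0 mf fK; rewrite unlock /Lnorm.
have -> : K%:E = ((K `^ 2)%:E `^ 2^-1)%E.
  by rewrite poweR_EFin -powRrM mulfV ?pnatr_eq0// powRr1.
(* The total mass is 1, so the constant is its own integral. *)
have -> : (K `^ 2)%:E = (\int[torus]_x (K `^ 2)%:E)%E.
  by rewrite integral_cst//= probability_setT mule1.
apply: gt0_ler_poweR.
- by rewrite invr_ge0.
- by rewrite in_itv/= leey andbT integral_ge0// => x _; rewrite poweR_ge0.
- by rewrite in_itv/= leey andbT integral_ge0// => x _; rewrite lee_fin powR_ge0.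
- apply: ae_ge0_le_integral => //.
  + by move=> x _; rewrite poweR_ge0.
  + have /measurable_EFinP mf' := mf.
    have mk := measurableT_comp (@abse_measurable R _) mf'.
    exact: (measurableT_comp (measurable_poweR 2) mk).
  + by move=> x _; rewrite lee_fin powR_ge0.
  + apply: (@filterS _ _ (ae_filter_ringOfSetsType torus)) fK => x fx _.
    by rewrite lee_fin ge0_ler_powR// nnegrE.
Qed.

Lemma L2T_norm_le (u : L2T R) (K : R) : 0 <= K ->
  (\forall x \ae torus, `|(u : R -> R) x| <= K) -> `|u| <= K.
Proof.
move=> K0 uK; rewrite Lspace_normE -lee_fin fineK.
  apply: Lnorm_torus_le => //; exact: L2T_measurable.
by rewrite ge0_fin_numE ?Lnorm_ge0//; exact: Lebesgue_finite.
Qed.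

(** * Functions glued from two pieces at 1/2 *)

Definition glue_half (P Q : R -> R) (x : R) : R := if x <= 2^-1 then P x else Q x.

Lemma measurable_glue_half (P Q : R -> R) :
  continuous P -> continuous Q -> measurable_fun setT (glue_half P Q).
Proof.
move=> cP cQ; apply: measurable_fun_if => //=.
- exact: measurable_fun_ler.
- apply: measurable_funTS; exact: continuous_measurable_fun.
- apply: measurable_funTS; exact: continuous_measurable_fun.
Qed.

Lemma L2T_glue_half (P Q : R -> R) : continuous P -> continuous Q ->
  exists u : L2T R, (u : R -> R) = glue_half P Q %[ae torus].
Proof.
move=> cP cQ.
(* The cutoff is bounded, hence in L^2, and does not change the class for the torus measure. *)
pose f := glue_half P Q \_ `[0, 1].
have bnd (S : R -> R) : continuous S -> exists K, {in `[0, 1], forall x, `|S x| <= K}.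
  move=> cS.
  have [|c _ h] := @EVT_max R (fun x => `|S x|) 0 1 ler01.
    by apply: continuous_subspaceT => z; apply: cvg_norm; exact: cS.
  by exists `|S c|.
have [[K PK] [L QL]] := (bnd _ cP, bnd _ cQ).
have mf : measurable_fun setT f.
  apply/(measurable_restrictT _ _).1 => //; apply: measurable_funTS.
  exact: measurable_glue_half.
have fP : f \in Lfun torus 2%:E.
  rewrite inE; apply/andP; split; rewrite inE//=.
  apply: (@le_lt_trans _ _ (`|K| + `|L|)%:E); last exact: ltry.
  apply: Lnorm_torus_le => //.
  apply: aeW => x; rewrite /f patchE; case: ifPn => [|_]; last first.
    by rewrite normr0.
  rewrite inE/= => x01; rewrite /glue_half; case: ifP => _.
    by rewrite (le_trans (PK _ x01))// (le_trans (ler_norm _))// lerDl.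
  by rewrite (le_trans (QL _ x01))// (le_trans (ler_norm _))// lerDr.
exists (Lspace_of_Lfun (Lfun_Sub (lee1n 2) fP)).
have : \forall x \ae torus, f x = glue_half P Q x.
  by apply/ae_torusP; apply: aeW => x x01; rewrite /f patchE ifT// inE.
have := Lspace_of_LfunE (Lfun_Sub (lee1n 2) fP).
move=> h1 h2; apply: (torusF2 _ h1 h2) => x /(_ I) e1 e2 _.
by rewrite e1.
Qed.

Lemma FTC2_C1 (P p : R -> R) (a b : R) : a <= b ->
  (forall x : R, is_derive x 1 P (p x)) -> continuous p ->
  \int[leb]_(t in `[a, b]) p t = P b - P a.
Proof.
rewrite le_eqVlt => /predU1P[->|ab] dP cp.
  by rewrite set_itv1 Rintegral_set1 subrr.
rewrite /Rintegral (@continuous_FTC2 _ _ P)//.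
- exact: continuous_subspaceT.
- have cP : continuous P.
    by move=> x; apply/differentiable_continuous/derivable1_diffP; have [] := dP x.
  split.
  + by move=> x _; have [] := dP x.
  + by apply: cvg_at_right_filter; exact: cP.
  + by apply: cvg_at_left_filter; exact: cP.
- by move=> x _; rewrite derive1E; have [] := dP x.
Qed.

(** Matching values at the junctions 1/2 and 0 = 1 make the glued function continuous and periodic,
    so it is a primitive of the glued derivative even if the latter jumps there. *)
Lemma torus_deriv_glue_half (P Q p q : R -> R) (v w : L2T R) :
  (forall x : R, is_derive x 1 P (p x)) -> (forall x : R, is_derive x 1 Q (q x)) ->
  continuous p -> continuous q -> P 2^-1 = Q 2^-1 -> P 0 = Q 1 ->
  (v : R -> R) = glue_half P Q %[ae torus] ->
  (w : R -> R) = glue_half p q %[ae torus] ->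
  torus_deriv v w.
Proof.
move=> dP dQ cp cq PQ PQ01 vE wE; exists (glue_half P Q); split => //.
  rewrite /glue_half invr_ge0 ler0n [1 <= _](_ : _ = false)//.
  by apply/negbTE; rewrite -ltNge; lra.
move=> x /andP[x0 x1].
have mg := measurable_glue_half _ _ cp cq.
have E (D : set R) : measurable D -> D `<=` `[0, 1] ->
    \int[leb]_(t in D) (w : R -> R) t = \int[leb]_(t in D) glue_half p q t.
  move=> mD D01; apply: ae_eq_Rintegral_torus => //.
  - by apply: measurable_funTS; exact: L2T_measurable.
  - exact: measurable_funTS.
have G0 : glue_half P Q 0 = P 0 by rewrite /glue_half invr_ge0 ler0n.
have Ep (y : R) : 0 <= y -> y <= 2^-1 ->
    \int[leb]_(t in `[0, y]) (w : R -> R) t = P y - P 0.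
  move=> y0 y2; rewrite E//; last first.
    by apply: subset_itvl; rewrite bnd_simp; lra.
  rewrite -(FTC2_C1 P p)//.
  apply: eq_Rintegral => t; rewrite inE/= in_itv/= /glue_half => /andP[_ ty].
  by rewrite (le_trans ty y2).
rewrite G0; have [x2|x2] := leP x 2^-1.
  by rewrite Ep// /glue_half x2; lra.
have intw : leb.-integrable `[0, x] (EFin \o w).
  apply: integrableS (L2T_integrable w) => //.
  by apply: subset_itvl; rewrite bnd_simp.
(* Beyond 1/2 the integral is split at 1/2, and the two increments telescope through [PQ]. *)
have h1 : (BLeft 0 <= BRight (2^-1 : R))%O by rewrite bnd_simp; lra.
have h2 : (BRight (2^-1 : R) <= BRight x)%O by rewrite bnd_simp ltW.
have /eqP := @Rintegral_itvB _ w (BLeft 0) (BRight x) 2^-1 intw h1 h2.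
rewrite subr_eq => /eqP ->.
have h0 : 0 <= 2^-1 :> R by rewrite invr_ge0.
rewrite Ep// E//; last first.
  by move=> t; apply: subset_itv; rewrite bnd_simp.
have -> : \int[leb]_(t in `]2^-1, x]) glue_half p q t = Q x - Q 2^-1.
  rewrite -(FTC2_C1 Q q) ?(ltW x2)// -Rintegral_itv_obnd_cbnd.
    apply: eq_Rintegral => t; rewrite inE/= in_itv/= /glue_half => /andP[ty _].
    by rewrite leNgt ty.
  have intq : leb.-integrable `[2^-1, x] (EFin \o q).
    apply: continuous_compact_integrable; first exact: segment_compact.
    exact: continuous_subspaceT.
  by apply: integrableS intq => //; apply: subset_itvr; rewrite bnd_simp.
by rewrite {1}/glue_half leNgt x2/=; lra.
Qed.

(** * The directional derivatives of F as multiplication by f'(u) *)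

Lemma L2T_sqr_norm (u : L2T R) :
  (\int[torus]_x ((u : R -> R) x ^+ 2)%:E = (`|u| ^+ 2)%:E)%E.
Proof.
have N : 'N[torus]_2%:E[EFin \o u]%E \is a fin_num.
  by rewrite ge0_fin_numE ?Lnorm_ge0//; exact: Lebesgue_finite.
rewrite Lspace_normE -powR_mulrn ?fine_ge0 ?Lnorm_ge0//.
rewrite -poweR_EFin fineK// poweR_Lnorm ?pnatr_eq0//.
apply: eq_integral => x _ /=; rewrite powR_mulrn//.
by rewrite real_normK// num_real.
Qed.

(* Fatou's lemma applied to [|q n - g|^2]. *)
Lemma L2T_cvg_ae (q : nat -> L2T R) (g : L2T R) (l : R -> R) :
  `|q n - g| @[n --> \oo] --> 0 ->
  (\forall x \ae torus, (q n : R -> R) x @[n --> \oo] --> l x) ->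
  (g : R -> R) = l %[ae torus].
Proof.
move=> qg ql.
pose phi n x := (((q n - g : L2T R) : R -> R) x ^+ 2)%:E.
have mphi n : measurable_fun setT (phi n).
  by apply/measurable_EFinP; apply: measurable_funX; exact: L2T_measurable.
have phi0 n x : (0 <= phi n x)%E by rewrite lee_fin sqr_ge0.
pose psi x := limn_einf (phi ^~ x).
have mpsi : measurable_fun setT psi.
  apply: (@emeasurable_fun_cvg _ _ _ _ (fun n x => einfs (phi ^~ x) n)).
    by move=> n; exact: measurable_fun_einfs.
  by move=> x _; rewrite /psi limn_einf_lim; exact: is_cvg_einfs.
have psi0 x : (0 <= psi x)%E.
  rewrite /psi limn_einf_lim; apply: lime_ge; first exact: is_cvg_einfs.
  by apply: nearW => n; apply: le_ereal_inf_tmp => _ [m _ <-].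
have Ipsi : (\int[torus]_x `|psi x| = 0)%E.
  under eq_integral do rewrite gee0_abs//.
  apply/eqP; rewrite eq_le integral_ge0// andbT.
  apply: le_trans (fatou torus measurableT mphi (fun n x _ => phi0 n x)) _.
  under eq_fun do rewrite L2T_sqr_norm.
  rewrite (@cvg_limn_einf_sup _ _ 0)//; apply: cvg_EFin; first exact: nearW.
  rewrite -[X in _ --> X](expr0n _ 2)/= expr2.
  under eq_fun do rewrite expr2.
  exact: cvgM.
have /ae_eq_integral_abs : (\int[torus]_x `|psi x| = 0)%E := Ipsi.
move=> /(_ measurableT mpsi) psiae.
have H : \forall x \ae torus, forall n,
    ((q n - g : L2T R) : R -> R) x = (q n : R -> R) x - (g : R -> R) x.
  apply: ae_foralln => n.
  apply: (torusF2 _ (LspaceD (q n) (- g)) (LspaceN g)) => x.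
  by move=> /(_ I) e1 /(_ I) e2; rewrite e1 e2.
apply: (torusF3 _ psiae ql H) => x /(_ I) psix qx Hx _.
(* The pointwise limit of [phi] must agree with its lower limit [psi], which is zero a.e. *)
have : (phi ^~ x) @ \oo --> ((l x - (g : R -> R) x) ^+ 2)%:E.
  apply: cvg_EFin; first exact: nearW.
  have -> : fine \o phi ^~ x = (fun n =>
      ((q n : R -> R) x - (g : R -> R) x) * ((q n : R -> R) x - (g : R -> R) x)).
    by apply/funext => n; rewrite /phi /= Hx expr2.
  rewrite expr2.
  by apply: cvgM; apply: cvgB => //; exact: cvg_cst.
move=> /cvg_limn_einf_sup[+ _]; rewrite -/(psi x) psix => -[/eqP].
by rewrite eq_sym sqrf_eq0 subr_eq0 => /eqP.
Qed.

(** The difference quotients converge to ['D_h F u] in norm and, [f] being differentiable, to f'(u)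
    h pointwise a.e.; [L2T_cvg_ae] identifies the two limits. *)
Lemma nemytskii_derive (f : R -> R) (F : L2T R -> L2T R) (u h : L2T R) :
  (forall x, derivable f x 1) ->
  (forall u : L2T R, (F u : R -> R) = (fun x => f ((u : R -> R) x)) %[ae torus]) ->
  derivable F u h ->
  ('D_h F u : R -> R) =
    (fun x => f^`()%classic ((u : R -> R) x) * (h : R -> R) x) %[ae torus].
Proof.
move=> df FE dF.
pose k (t : R) : L2T R := t^-1 *: (F (t *: h + u) - F u).
have kD : k t @[t --> 0^'] --> 'D_h F u by exact: dF.
(* Passing to a sequence of increments leaves only countably many exceptional null sets to unite. *)
have seq0 : (forall n : nat, @harmonic R n != 0) /\ @harmonic R n @[n --> \oo] --> 0.
  by split=> [n|]; [rewrite gt_eqF// harmonic_gt0|exact: cvg_harmonic].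
apply: (@L2T_cvg_ae (fun n => k (harmonic n))).
  have : (`|k t - 'D_h F u| : R) @[t --> 0^'] --> (0 : R).
    rewrite -[X in _ --> X](@normr0 _ (L2T R)) -(subrr ('D_h F u)).
    by apply: cvg_norm; apply: cvgB => //; exact: cvg_cst.
  by move=> /cvgr_dnbhsP /(_ _ seq0).
have H : \forall x \ae torus, forall n, (k (harmonic n) : R -> R) x =
    (harmonic n)^-1 *
      (f (harmonic n * (h : R -> R) x + (u : R -> R) x) - f ((u : R -> R) x)).
  apply: ae_foralln => n; rewrite /k; move: (harmonic n) => t.
  have sub := torusF2 _ (LspaceD (F (t *: h + u)) (- F u)) (LspaceN (F u)).
  have {sub} Fsub : \forall x \ae torus, (F (t *: h + u) - F u : R -> R) x =
      (F (t *: h + u) : R -> R) x - (F u : R -> R) x.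
    by apply: sub => x /(_ I) e1 /(_ I) e2; rewrite e1 e2.
  have Fth : \forall x \ae torus, (F (t *: h + u) : R -> R) x =
      f (t * (h : R -> R) x + (u : R -> R) x).
    apply: (torusF2 _ (FE (t *: h + u)) (L2T_linE t h u)) => x.
    by move=> /(_ I) e1 /(_ I) e2; rewrite e1 e2.
  have D : \forall x \ae torus, (F (t *: h + u) - F u : R -> R) x =
      f (t * (h : R -> R) x + (u : R -> R) x) - f ((u : R -> R) x).
    by apply: (torusF3 _ Fsub Fth (FE u)) => x e1 e2 /(_ I) e3; rewrite e1 e2 e3.
  apply: (torusF2 _ D (LspaceZ t^-1 (F (t *: h + u) - F u))) => x e /(_ I) e4.
  by rewrite e4 e.
apply: torusF H => x Hx; under eq_fun do rewrite Hx.
have : (t^-1 * (f (t * (h : R -> R) x + (u : R -> R) x) - f ((u : R -> R) x)))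
    @[t --> 0^'] -->
  f^`()%classic ((u : R -> R) x) * (h : R -> R) x.
  move: ((h : R -> R) x) ((u : R -> R) x) => y z.
  have dfz : differentiable f z by apply/derivable1_diffP.
  have -> : f^`()%classic z * y = 'D_y f z.
    rewrite derive1E !deriveE//.
    rewrite -{2}(mulr1 y).
    have -> : y * 1 = y *: (1 : R) by [].
    by rewrite linearZ mulrC.
  exact: diff_derivable.
by move=> /cvgr_dnbhsP /(_ _ seq0); exact.
Qed.

(** * Computing with representatives and scaling the graph *)

Lemma L2T_eq_unique (u v : L2T R) (f : R -> R) :
  (u : R -> R) = f %[ae torus] -> (v : R -> R) = f %[ae torus] -> u = v.
Proof.
move=> uf vf; apply/LspaceP; apply: (torusF2 _ uf vf) => x /(_ I) e1 /(_ I) e2 _.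
by rewrite e1 e2.
Qed.

Lemma L2T_eqB (u v : L2T R) (f g : R -> R) :
  (u : R -> R) = f %[ae torus] -> (v : R -> R) = g %[ae torus] ->
  (u - v : R -> R) = (fun x => f x - g x) %[ae torus].
Proof.
move=> uf vg; have D := LspaceD u (- v); have N := LspaceN v.
have {D}{}N : \forall x \ae torus,
    (u - v : R -> R) x = (u : R -> R) x - (v : R -> R) x.
  by apply: (torusF2 _ D N) => x /(_ I) e1 /(_ I) e2; rewrite e1 e2.
by apply: (torusF3 _ N uf vg) => x e /(_ I) e1 /(_ I) e2 _; rewrite e e1 e2.
Qed.

Lemma L2T_eqZ (a : R) (u : L2T R) (f : R -> R) :
  (u : R -> R) = f %[ae torus] -> (a *: u : R -> R) = (fun x => a * f x) %[ae torus].
Proof.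
move=> uf; apply: (torusF2 _ uf (LspaceZ a u)) => x /(_ I) e1 /(_ I) e2 _.
by rewrite e2 e1.
Qed.

Lemma L2T_eqD (u v : L2T R) (f g : R -> R) :
  (u : R -> R) = f %[ae torus] -> (v : R -> R) = g %[ae torus] ->
  (u + v : R -> R) = (fun x => f x + g x) %[ae torus].
Proof.
move=> uf vg; apply: (torusF3 _ (LspaceD u v) uf vg) => x.
by move=> /(_ I) e /(_ I) e1 /(_ I) e2 _; rewrite e e1 e2.
Qed.

Lemma laplacian_graphZ (a : R) (v w : L2T R) :
  laplacian_graph v w -> laplacian_graph (a *: v) (a *: w).
Proof.
(* Subtracting the pair from itself puts (0, 0) in the graph, and scaling is then the case of a
   linear combination with (0, 0). *)
move=> vw; have := laplacian_graph_lin (-1) _ _ _ _ vw vw.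
rewrite !scaleN1r !addNr => /(laplacian_graph_lin a _ _ _ _ vw).
by rewrite !addr0.
Qed.

(** * Affine f: the derivative is a scalar and the bound holds *)

Lemma nemytskii_affine (a b : R) (F : L2T R -> L2T R) :
  (forall u : L2T R, (F u : R -> R) = (fun x => a * (u : R -> R) x + b) %[ae torus]) ->
  F = (fun u => a *: u + F 0).
Proof.
move=> FE; apply/funext => u; apply: L2T_eq_unique (FE u) _.
have F0 : (F 0 : R -> R) = (fun=> b) %[ae torus].
  apply: (torusF2 _ (FE 0) (@Lspace0 _ _ _ torus _ (lee1n 2))) => x.
  by move=> /(_ I) e1 /(_ I) e2 _; rewrite e1 e2 mulr0 add0r.
apply: (torusF3 _ (LspaceD (a *: u) (F 0)) (LspaceZ a u) F0) => x.
by move=> /(_ I) e1 /(_ I) e2 /(_ I) e3 _; rewrite e1 e2 e3.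
Qed.

(** Here F'(u) is the scalar [a], which commutes with 1 - Delta, so the conjugated operator is again
    multiplication by [a]. *)
Lemma conjugate_bound_affine (f : R -> R) (F : L2T R -> L2T R) :
  (forall u : L2T R, (F u : R -> R) = (fun x => f ((u : R -> R) x)) %[ae torus]) ->
  (exists a b : R, forall x, f x = a * x + b) ->
  (forall u : L2T R, gateaux_differentiable F u) /\
   (exists L : R, 0 < L /\
      forall u v : L2T R, dom_laplacian v ->
        `|inv_one_minus_laplacian ('D_(one_minus_laplacian v) F u)|
          <= L * `|v|).
Proof.
move=> FE [a [b fE]].
have FA : F = (fun u => a *: u + F 0).
  apply: (@nemytskii_affine a b) => u; apply: torusF (FE u) => x e /e ->.
  by rewrite fE.
have dF (u v : L2T R) : is_derive u v F (a *: v).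
  have := is_deriveD (is_deriveZ a (is_derive_id u v)) (is_derive_cst (F 0) u v).
  rewrite [in X in _ -> X]FA.
  by rewrite addr0.
split=> [u|].
  exists (a \*: idfun : {linear L2T R -> L2T R}); split => [|v]; last exact: dF.
  exact: scaler_continuous.
(* Adding 1 keeps the constant positive when [a] is zero. *)
exists (`|a| + 1); split=> [|u v [w vw]]; first by rewrite ltr_wpDl.
rewrite /one_minus_laplacian (laplacianE _ _ vw).
have [_ ->] := dF u (v - w).
rewrite scalerBr inv_one_minus_laplacianE; last exact: laplacian_graphZ.
by rewrite normrZ ler_wpM2r// lerDl.
Qed.

(** * The bound forces f' to be constant *)

Lemma derive_cst_affine (f : R -> R) :
  (forall x, derivable f x 1) ->
  (forall x y, f^`()%classic x = f^`()%classic y) ->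
  exists a b : R, forall x, f x = a * x + b.
Proof.
move=> df f'; exists (f^`()%classic 0), (f 0) => x.
pose g (y : R) := f y - f^`()%classic 0 * y.
have dg (y : R) : is_derive y 1 g 0.
  have dfy : is_derive y 1 f (f^`()%classic 0).
    by apply: DeriveDef; [exact: df|rewrite -derive1E; exact: f'].
  by apply: is_derive_eq; rewrite scaler1 subrr.
have := @is_derive_0_is_cst R g x 0 dg.
by rewrite /g mulr0 subr0 => <-; rewrite addrC subrK.
Qed.

(** The witnesses are odd multiples of 2 pi. For such [t] the function sin (t x) / t, cut off to
    [0, 1/2], is continuous on the torus, and its derivative jumps by +1 at both 0 and 1/2, whatever
    [t] is. *)
Lemma cos_period_unbounded (B : R) :
  exists t : R, [/\ B < t, 0 < t, cos (t / 2) = -1 & sin (t / 2) = 0].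
Proof.
pose t (n : nat) : R := pi + pi *+ 2 *+ n.
have ct n : cos (t n) = -1 /\ sin (t n) = 0.
  elim: n => [|n [c s]]; first by rewrite /t mulr0n addr0 cospi sinpi.
  have -> : t n.+1 = t n + pi *+ 2 by rewrite /t mulrSr addrA.
  by rewrite mulr2n addrA !cosDpi !sinDpi !opprK.
have [n Bn] : exists n : nat, `|B| < n%:R.
  by exists (Num.truncn `|B|).+1; rewrite truncnS_gt.
have tn : n%:R <= t n.
  have -> : t n = pi * (1 + 2 * n%:R) by rewrite /t -mulrnA -(mulr_natr pi) natrM; ring.
  have p2 := @pi_ge2 R; have n0 : 0 <= n%:R :> R by [].
  nra.
exists (2 * t n); split.
- rewrite (le_lt_trans (ler_norm _))// (lt_le_trans Bn)// (le_trans tn)//.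
  have := lt_le_trans (le_lt_trans (normr_ge0 B) Bn) tn.
  lra.
- have := lt_le_trans (le_lt_trans (normr_ge0 B) Bn) tn.
  lra.
- by rewrite mulrAC mulfV ?mul1r ?pnatr_eq0//; case: (ct n).
- by rewrite mulrAC mulfV ?mul1r ?pnatr_eq0//; case: (ct n).
Qed.

Lemma conjugate_bound_derive1_cst (f : R -> R) (F : L2T R -> L2T R) (L x0 y0 : R) :
  (forall x, derivable f x 1) ->
  (forall u : L2T R, (F u : R -> R) = (fun x => f ((u : R -> R) x)) %[ae torus]) ->
  (forall u h, derivable F u h) -> 0 < L ->
  (forall u v : L2T R, dom_laplacian v ->
    `|inv_one_minus_laplacian ('D_(one_minus_laplacian v) F u)| <= L * `|v|) ->
  f^`()%classic x0 = f^`()%classic y0.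
Proof.
move=> df FE dF L0 FL.
pose c := f^`()%classic y0.
pose d := f^`()%classic x0 - c.
apply/eqP; rewrite -subr_eq0 -/c -/d; apply/negPn/negP => d0.
(* [ch] and [sh] are twice the hyperbolic cosine and sine. *)
pose ch (x : R) := expR x + expR (- x).
pose sh (x : R) := expR x - expR (- x).
have chN x : ch (- x) = ch x by rewrite /ch opprK addrC.
have shN x : sh (- x) = - sh x by rewrite /sh opprK opprB.
have sh0 : 0 < sh 4^-1 by rewrite /sh subr_gt0 ltr_expR; lra.
(* With this normalisation [s * sh] runs from -1/2 to 1/2 on each half of the torus, so k' jumps by
   -1 at 0 and at 1/2. *)
pose s := (2 * sh 4^-1)^-1.
have s0 : 0 < s by rewrite invr_gt0 mulr_gt0.
have ssh : s * sh 4^-1 = 2^-1 by rewrite /s; field; rewrite gt_eqF.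
have sub1 : 2^-1 - 4^-1 = 4^-1 :> R by field.
have sub2 : 2^-1 - 3 / 4 = - 4^-1 :> R by field.
have sub3 : 1 - 3 / 4 = 4^-1 :> R by field.
have dch (a x : R) : is_derive x 1 (fun x => s * ch (x - a)) (s * sh (x - a)).
  by rewrite /ch /sh; apply: is_derive_eq; rewrite /GRing.scale/=; ring.
have dsh (a x : R) : is_derive x 1 (fun x => s * sh (x - a)) (s * ch (x - a)).
  by rewrite /ch /sh; apply: is_derive_eq; rewrite /GRing.scale/=; ring.
have cont (P p : R -> R) : (forall x : R, is_derive x 1 P (p x)) -> continuous P.
  by move=> dP x; apply/differentiable_continuous/derivable1_diffP; have [] := dP x.
have [k kE] : exists k : L2T R, (k : R -> R) =
    glue_half (fun x => s * ch (x - 4^-1)) (fun x => s * ch (x - (3 / 4))) %[ae torus].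
  by apply: L2T_glue_half; apply: cont => x; exact: dch.
have k0 : 0 < `|k|.
  rewrite normr_gt0; apply/eqP => k0; rewrite k0 in kE.
  (* The representative of [k] is positive everywhere, so [k = 0] would make the whole space null,
     against total mass 1. *)
  have [A [mA A0 sA]] : \forall x \ae torus, False.
    apply: (torusF2 _ kE (@Lspace0 _ _ _ torus _ (lee1n 2))) => x /(_ I) -> /(_ I) /eqP.
    have ch0 (y : R) : 0 < s * ch y by rewrite mulr_gt0// addr_gt0// expR_gt0.
    by rewrite /glue_half; case: ifP => _; rewrite gt_eqF.
  have AT : A = setT by apply/seteqP; split => // x _; exact: sA.
  by move: A0; rewrite AT probability_setT => /eqP; rewrite onee_eq0.
(* The final estimate bounds the frequency [w] by [B], so any larger [w] gives the contradiction. *)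
pose B := (L + `|c| + `|d|) / (`|d| * `|k|).
have [w [Bw w0 cosw2 sinw2]] := cos_period_unbounded B.
have wE : w = w / 2 + w / 2 by rewrite -splitr.
have cosw : cos w = 1 by rewrite wE cosD cosw2 sinw2; ring.
have sinw : sin w = 0 by rewrite wE sinD cosw2 sinw2; ring.
pose S (x : R) := sin (w * x) / w.
pose S' (x : R) := cos (w * x).
pose S'' (x : R) := - (w * sin (w * x)).
have dS (x : R) : is_derive x 1 S (S' x).
  rewrite /S /S'; apply: is_derive_eq; rewrite /GRing.scale/=.
  by field; rewrite gt_eqF.
have dS' (x : R) : is_derive x 1 S' (S'' x).
  by rewrite /S' /S''; apply: is_derive_eq; rewrite /GRing.scale/=; ring.
have cS'' : continuous S''.
  apply: (cont _ (fun x => - w ^+ 2 * cos (w * x))) => x.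
  by rewrite /S''; apply: is_derive_eq; rewrite /GRing.scale/=; ring.
have [v vE] := L2T_glue_half S S (cont _ _ dS) (cont _ _ dS).
have [v' v'E] := L2T_glue_half S' S' (cont _ _ dS') (cont _ _ dS').
have [v'' v''E] := L2T_glue_half S'' S'' cS'' cS''.
have vv'' : laplacian_graph v v''.
  exists v'.
    apply: (torus_deriv_glue_half S S S' S') => //.
    - exact: cont dS'.
    - exact: cont dS'.
    - by rewrite /S mulr0 mulr1 sin0 sinw.
  by apply: (torus_deriv_glue_half S' S' S'' S'') => //; rewrite /S' mulr0 mulr1 cos0 cosw.
(* [P] and [Q] are the two branches of e = 1_I v + k. *)
pose P (x : R) := S x + s * ch (x - 4^-1).
pose P' (x : R) := S' x + s * sh (x - 4^-1).
pose P'' (x : R) := S'' x + s * ch (x - 4^-1).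
pose Q (x : R) := s * ch (x - (3 / 4)).
pose Q' (x : R) := s * sh (x - (3 / 4)).
have dP (x : R) : is_derive x 1 P (P' x) by exact: is_deriveD.
have dP' (x : R) : is_derive x 1 P' (P'' x) by exact: is_deriveD.
have dQ (x : R) : is_derive x 1 Q (Q' x) by exact: dch.
have dQ' (x : R) : is_derive x 1 Q' (Q x) by exact: dsh.
have cP'' : continuous P''.
  by move=> x; apply: cvgD; [exact: cS''|exact: (cont _ _ (dch 4^-1))].
have [e eE] := L2T_glue_half P Q (cont _ _ dP) (cont _ _ dQ).
have [e' e'E] := L2T_glue_half P' Q' (cont _ _ dP') (cont _ _ dQ').
have [e'' e''E] := L2T_glue_half P'' Q cP'' (cont _ _ dQ).
have ee'' : laplacian_graph e e''.
  exists e'.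
    apply: (torus_deriv_glue_half P Q P' Q') => //; [exact: cont dP'|exact: cont dQ'|..].
      (* The values match because [S] vanishes at 0 and 1/2 and [ch] is even. *)
      by rewrite /P /Q sub1 sub2 chN /S sinw2 mul0r add0r.
    by rewrite /P /Q sub3 sub0r chN /S mulr0 sin0 mul0r add0r.
  apply: (torus_deriv_glue_half P' Q' P'' Q) => //; [exact: cont dQ|..].
    (* The derivatives match too: -1 + 1/2 = -1/2 at 1/2, and 1 - 1/2 = 1/2 at 0. *)
    by rewrite /P' /Q' sub1 sub2 shN mulrN ssh /S' cosw2; field.
  by rewrite /P' /Q' sub3 sub0r shN mulrN ssh /S' mulr0 cos0; field.
have cstc (a : R) : continuous (cst a : R -> R).
  apply: (cont _ (cst 0)) => x; exact: is_derive_cst.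
have [u uE] := L2T_glue_half (cst x0) (cst y0) (cstc _) (cstc _).
(* Multiplication by c + d 1_I takes [v - v''] to this difference, since k = k'' on both pieces
   gives e - e'' = 1_I (v - v''). *)
have D : 'D_(v - v'') F u = (c *: v + d *: e) - (c *: v'' + d *: e'').
  apply: (@L2T_eq_unique _ _ (fun x => f^`()%classic
    (glue_half (cst x0) (cst y0) x) * (glue_half S S x - glue_half S'' S'' x))).
    have h := L2T_eqB _ _ _ _ vE v''E.
    apply: (torusF3 _ (nemytskii_derive _ _ _ _ df FE (dF u (v - v''))) uE h).
    by move=> x /(_ I) e1 /(_ I) e2 /(_ I) e3 _; rewrite e1 e2 e3.
  have h := L2T_eqB _ _ _ _
    (L2T_eqD _ _ _ _ (L2T_eqZ c _ _ vE) (L2T_eqZ d _ _ eE))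
    (L2T_eqD _ _ _ _ (L2T_eqZ c _ _ v''E) (L2T_eqZ d _ _ e''E)).
  apply: torusF h => x /(_ I) -> _.
  rewrite /glue_half /P /P'' /d /c; case: ifP => _; ring.
have we : laplacian_graph (c *: v + d *: e) (c *: v'' + d *: e'').
  exact: laplacian_graph_lin (laplacian_graphZ _ _ _ ee'').
have := FL u v (ex_intro _ _ vv'').
rewrite /one_minus_laplacian (laplacianE _ _ vv'') D inv_one_minus_laplacianE// => bound.
have Sw x : `|S x| <= w^-1.
  rewrite /S normrM [X in _ * X]gtr0_norm ?invr_gt0// ler_piMl ?invr_ge0 ?(ltW w0)//.
  exact: sin_max.
have vw : `|v| <= w^-1.
  apply: L2T_norm_le; first by rewrite invr_ge0 ltW.
  by apply: torusF vE => x /(_ I) ->; rewrite /glue_half if_same.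
(* Here k - e = - 1_I v, which is bounded by 1 / w like [S]. *)
have ke : `|k - e| <= w^-1.
  apply: L2T_norm_le; first by rewrite invr_ge0 ltW.
  apply: torusF (L2T_eqB _ _ _ _ kE eE) => x /(_ I) ->.
  rewrite /glue_half /P /Q; case: ifP => _; last by rewrite subrr normr0 invr_ge0 ltW.
  by rewrite opprD addrCA subrr addr0 normrN.
have kb : `|k| <= `|e| + w^-1.
  rewrite -[leLHS](_ : `|e + (k - e)| = _); last by rewrite addrC subrK.
  by rewrite (le_trans (ler_normD _ _))// lerD2l.
(* Since d e = (c v + d e) - c v, the assumed bound controls the first term by [L] times the norm of
   [v]. *)
have eb : `|d| * `|e| <= (L + `|c|) * `|v|.
  rewrite -normrZ -[leLHS](_ : `|(c *: v + d *: e) - c *: v| = _).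
    by rewrite (le_trans (ler_normB _ _))// mulrDl normrZ lerD2r.
  by rewrite addrAC subrr add0r.
have : `|d| * `|k| <= (L + `|c| + `|d|) * w^-1.
  have := ler_wpM2l (normr_ge0 d) kb.
  have := ler_wpM2l (addr_ge0 (ltW L0) (normr_ge0 c)) vw.
  by rewrite mulrDr [in X in _ -> _ -> X]mulrDl; move: eb; lra.
have dk0 : 0 < `|d| * `|k| by rewrite mulr_gt0// normr_gt0.
rewrite ler_pdivlMr// -ler_pdivlMl// mulrC leNgt.
by rewrite -/B Bw.
Qed.

End torus_sobolev.

Theorem proposition1p2 (R : realType) (f : R -> R)
    (f_derivable : forall x : R, derivable f x 1)
    (f'_bounded : exists M : R, forall x : R, `|(f^`())%classic x| <= M)
    (F : L2T R -> L2T R)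
    (FE : forall u : L2T R,
      (F u : R -> R) = (fun x => f ((u : R -> R) x)) %[ae torus_measure R]) :
  ((forall u : L2T R, gateaux_differentiable F u) /\
   (exists L : R, 0 < L /\
      forall u v : L2T R, dom_laplacian v ->
        `|inv_one_minus_laplacian ('D_(one_minus_laplacian v) F u)|
          <= L * `|v|))
  <->
  (exists a b : R, forall x : R, f x = a * x + b).
Proof.
split=> [[Fgateaux [L [L0 FL]]]|]; last exact: conjugate_bound_affine.
apply: derive_cst_affine => // x y.
apply: (conjugate_bound_derive1_cst _ _ _ _ _ f_derivable FE _ L0 FL) => u h.
by have [A [_ dA]] := Fgateaux u; have [] := dA h.
Qed.
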